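(* Let $f$ be an $S$-perfect structure over the $q$-ary $mk$-cube $H_q^{mk}$. Let $R$ be the set of zeroes of the function $\tilde g:V(H_q^{mk})\to V(H_q^k)$, $\tilde g(x_1,\dots,x_m)=x_1+\dots+x_m \bmod q$, $x_i\in V(H_q^k)$, and let $f_0$ be the sum of $f$ over $R$. Then the weight distribution of $f$ with respect to $R$ is $$\bigl(f_0=f_0\Pi_0(\tfrac1mS),\ f_0\Pi_1(\tfrac1mS),\ \dots,\ f_0\Pi_k(\tfrac1mS)\bigr)^{T},$$ where $\Pi_i(\cdot)=P_i(P_1^{-1}(\cdot))$ and $P_i(\cdot)=P_i(\cdot;k,q)$ are the Krawtchouk polynomials. The corresponding weight enumerator equals $f_0\,Z_{\frac1mS;k,q}(z)$.
   Context: The $q$-ary $n$-cube $H_q^n$ ($q\ge2$) is the graph whose vertices are all words of length $n$ over $\{0,\dots,q-1\}$, two words being adjacent iff they differ in exactly one position. With $A$ its adjacency matrix and $S$ a real $\nu\times\nu$ matrix, an $S$-perfect structure over $H_q^n$ is a real $q^n\times\nu$ matrix $f$ with $Af=fS$, regarded also as a function on vertices with values the rows of $f$. Here $m,k$ are positive integers; a vertex of $H_q^{mk}$ is written as $(x_1,\dots,x_m)$ with each $x_i$ a word of length $k$; addition modulo $q$ is coordinatewise; a zero of $\tilde g$ is a vertex mapped to the all-zero word. The weight distribution of $f$ with respect to a vertex set $C$ is $(h_0,\dots,h_{\rho})^T$, where $h_w$ is the sum of $f(v)$ over all vertices $v$ at distance $w$ from $C$ and $\rho$ is the maximum distance of a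 vertex from $C$; the corresponding weight enumerator is $h_0+zh_1+\dots+z^{\rho}h_\rho$, $z$ a real variable. Krawtchouk polynomials: $P_w(x;n,q)=\sum_{j=0}^w(-1)^j(q-1)^{w-j}\binom{x}{j}\binom{n-x}{w-j}$; in particular $P_1(x;n,q)=(q-1)n-qx$, so $P_1^{-1}(y)=((q-1)n-y)/q$, and $P_i(P_1^{-1}(\cdot))$ is a polynomial, which can be evaluated at a square matrix. $Z_{M;n,q}(z)=(1-z)^{((q-1)nI-M)/q}(1+(q-1)z)^{(nI+M)/q}$ for a square matrix $M$, where $I$ is the identity matrix and $t^X=\exp(X\ln t)$ for real $t>0$; the formula is understood for real $z$ with $1-z>0$ and $1+(q-1)z>0$. *)

(* Defs.v *)
From mathcomp Require Import all_boot all_order all_algebra.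
From mathcomp Require Import all_classical all_reals all_analysis.
From mathcomp Require Import ring.

Set Implicit Arguments.
Unset Strict Implicit.
Unset Printing Implicit Defensive.

Import Order.TTheory GRing.Theory Num.Theory.
Import numFieldNormedType.Exports.

Local Open Scope ring_scope.

Section Graph.
Variables (T : finType) (e : rel T).

(* Least length of a walk from x to y; #|T| when there is none. *)
Definition gdist (x y : T) : nat :=
  find (fun d => [exists p : d.-tuple T, path e x p && (last x p == y)])
       (iota 0 #|T|).

(* #|T| bounds all distances, so it is a neutral default for the minimum. *)
Definition set_dist (C : {set T}) (v : T) : nat :=
  \big[minn/#|T|]_(c in C) gdist c v.

Definition covering_radius (C : {set T}) : nat := \max_(v : T) set_dist C v.

Variable R : realType.

Definition adjacency_mx : 'M[R]_#|T| :=
  \matrix_(i, j) (e (enum_val i) (enum_val j))%:R.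

Variable nu : nat.

Definition perfect_structure (S : 'M[R]_nu) (f : 'M[R]_(#|T|, nu)) : Prop :=
  adjacency_mx *m f = f *m S.

Definition value (f : 'M[R]_(#|T|, nu)) (v : T) : 'rV[R]_nu :=
  row (enum_rank v) f.

(* The entries h_0, ..., h_rho are rows of length nu, listed in this order. *)
Definition weight_distribution (f : 'M[R]_(#|T|, nu)) (C : {set T}) :
    seq 'rV[R]_nu :=
  mkseq (fun w => \sum_(v | set_dist C v == w) value f v)
        (covering_radius C).+1.

Definition weight_enumerator (f : 'M[R]_(#|T|, nu)) (C : {set T}) (z : R) :
    'rV[R]_nu :=
  let h := weight_distribution f C in \sum_(w < size h) z ^+ w *: h`_w.

End Graph.

(* Words of length n over Z/qZ; 'Z_q is Z/qZ only for 1 < q. *)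
Notation vertex q n := ('rV['Z_q]_n).

Definition cube_adj (q n : nat) : rel (vertex q n) :=
  fun u v => #|[pred i | u 0 i != v 0 i]| == 1%N.

(* vec_mx is row-major: row i of vec_mx x is the i-th of the m consecutive
   blocks of length k of x. *)
Definition block_sum (q m k : nat) (x : vertex q (m * k)) : vertex q k :=
  \sum_(i < m) row i (vec_mx x).

Definition block_sum_zeros (q m k : nat) : {set vertex q (m * k)} :=
  finset (fun x => block_sum x == 0).

Section Krawtchouk.
Variable R : realType.

(* The polynomial X (X - 1) ... (X - j + 1) / j!. *)
Definition bin_poly (j : nat) : {poly R} :=
  (j`!%:R)^-1 *: \prod_(l < j) ('X - l%:R%:P).

Definition krawtchouk (w n q : nat) : {poly R} :=
  \sum_(j < w.+1) ((-1) ^+ j * (q%:R - 1) ^+ (w - j)) *: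
    (bin_poly j * (bin_poly (w - j) \Po (n%:R%:P - 'X))).

Definition krawtchouk1_inv (n q : nat) : {poly R} :=
  q%:R^-1 *: (((q%:R - 1) * n%:R)%:P - 'X).

Definition krawtchouk_Pi (i n q : nat) : {poly R} :=
  krawtchouk i n q \Po krawtchouk1_inv n q.

Lemma bin_polyE (j n : nat) : (bin_poly j).[n%:R] = 'C(n, j)%:R.
Proof.
have j0 : j`!%:R != 0 :> R by rewrite pnatr_eq0 -lt0n fact_gt0.
rewrite /bin_poly hornerZ horner_prod; apply: (mulfI j0).
rewrite mulrA mulfV // mul1r -natrM mulnC bin_ffact.
elim: j {j0} => [|j IH]; first by rewrite big_ord0 ffactn0.
rewrite big_ord_recr /= IH !hornerE ffactnSr natrM.
by case: (leqP j n) => [h|h]; [rewrite natrB | rewrite ffact_small // !mul0r].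
Qed.

Lemma krawtchouk1E (n q : nat) :
  krawtchouk 1 n q = ((q%:R - 1) * n%:R)%:P - q%:R *: 'X.
Proof.
have b0 : bin_poly 0 = 1 by rewrite /bin_poly big_ord0 invr1 scale1r.
have b1 : bin_poly 1 = 'X.
  by rewrite /bin_poly big_ord1 invr1 scale1r subr0.
rewrite /krawtchouk big_ord_recl big_ord1 /= subnn subn0 b0 b1.
rewrite comp_polyX comp_polyC !expr0 !expr1 ?mulr1 ?mul1r.
by rewrite -!mul_polyC !(polyCM, polyCB, polyCN); ring.
Qed.

Lemma krawtchouk1K (n q : nat) : (0 < q)%N ->
  krawtchouk 1 n q \Po krawtchouk1_inv n q = 'X.
Proof.
move=> q0; have qn0 : q%:R != 0 :> R by rewrite pnatr_eq0 -lt0n.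
rewrite krawtchouk1E comp_polyB comp_polyC comp_polyZ comp_polyX.
by rewrite /krawtchouk1_inv scalerA mulfV // scale1r opprB addrC subrK.
Qed.

End Krawtchouk.

Section MatrixFunctions.
Variables (R : realType) (nu : nat).
Implicit Types X M : 'M[R]_nu.+1.

Definition mx_exp X : 'M[R]_nu.+1 :=
  limn (series (fun n => (n`!%:R)^-1 *: X ^+ n)).

(* t ^ X, meaningful for 0 < t. *)
Definition mx_rpow (t : R) X : 'M[R]_nu.+1 := mx_exp (ln t *: X).

Definition Zmx M (n q : nat) (z : R) : 'M[R]_nu.+1 :=
  mx_rpow (1 - z) (q%:R^-1 *: (((q%:R - 1) * n%:R)%:M - M)) *m
  mx_rpow (1 + (q%:R - 1) * z) (q%:R^-1 *: (n%:R%:M + M)).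

End MatrixFunctions.

(* Main.v *)
Require Import Defs.
From mathcomp Require Import all_boot all_order all_algebra.
From mathcomp Require Import all_classical all_reals all_analysis.
From mathcomp Require Import ring zify.

Set Implicit Arguments.
Unset Strict Implicit.
Unset Printing Implicit Defensive.

Import Order.TTheory GRing.Theory Num.Theory.
Import numFieldNormedType.Exports.

Local Open Scope ring_scope.

(** Summing over blocks, [block_sum : H_q^(mk) -> H_q^k], covers every edge of
    the small cube evenly: the neighbors of [x] are sent onto the neighbors of
    [block_sum x], m to one.  It also turns the distance from the zero set
    into the Hamming weight of the block sum, because an error in the block sum
    can be repaired inside one block and never with fewer changes.  So the sums
    [h_w] of f over the levels of that distance obey the three-term relation of
    the weight levels in the small cube,
      [h_w (S/m) = (q-1)(k-w+1) h_(w-1) + (q-2) w h_w + (w+1) h_(w+1)],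
    which is the recurrence of the polynomials [Pi_w]; hence
    [h_w = h_0 Pi_w(S/m)] ([level_sum_krawtchouk]).

    For the weight enumerator no calculus on matrix functions is needed.  The
    relation at w = k says [h_0 Pi_(k+1)(S/m) = h_(k+1) = 0], and [Pi_(k+1)] is
    a constant times the product of the [X - l_i], where [l_i = (q-1)k - qi]
    for i from 0 to k are distinct.  So [h_0] is a sum of row eigenvectors of
    [S/m] for the [l_i] ([level_sum0_eigen_decomposition]).  On an eigenvector
    every function of [S/m] acts as a scalar, the matrix exponential included
    once its series is known to converge ([row_mul_mx_exp]), and the claim
    reduces to the scalar generating function
      [sum_w z^w P_w(i) = (1-z)^i (1+(q-1)z)^(k-i)]. *)

(** * The Hamming metric on the cube *)

Section HammingCube.
Variables (q n : nat).
Implicit Types u v x y : vertex q n.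

Definition hamming_weight x : nat := \sum_i (x 0%R i != 0%R).

Local Notation wt := hamming_weight.

Lemma cube_adjE x y : cube_adj x y = (wt (y - x)%R == 1)%N.
Proof.
rewrite /cube_adj /wt -sum1_card -big_mkcond; congr (_ == _).
by apply: eq_bigl => i; rewrite !mxE subr_eq0 eq_sym inE.
Qed.

Lemma hamming_weightN x : wt (- x) = wt x.
Proof. by apply: eq_bigr => i _; rewrite mxE oppr_eq0. Qed.

Lemma hamming_weight_eq0 x : (wt x == 0)%N = (x == 0).
Proof.
rewrite sum_nat_eq0; apply/forallP/eqP => [h|-> i]; last by rewrite mxE eqxx.
by apply/rowP => i; have := h i; rewrite mxE; case: (eqVneq (x 0 i) 0).
Qed.

Lemma hamming_weight_le x : (wt x <= n)%N.
Proof.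
rewrite -[leqRHS](card_ord n) -sum1_card.
by apply: leq_sum => i _; case: eqP.
Qed.

Lemma hamming_weightD x y : (wt (x + y) <= wt x + wt y)%N.
Proof.
rewrite -big_split; apply: leq_sum => i _; rewrite /= !mxE.
by case: (x 0 i =P 0) => [->|]; rewrite ?add0r //=; case: (_ != 0).
Qed.

Lemma hamming_weight_sum (I : finType) (F : I -> vertex q n) :
  (wt (\sum_i F i) <= \sum_i wt (F i))%N.
Proof.
pose K u s := is_true (wt u <= s)%N.
apply: (@big_ind2 _ _ K) => [|x a y b ha hb|i _]; last exact: leqnn.
  by rewrite /K leqn0 hamming_weight_eq0.
exact: leq_trans (hamming_weightD _ _) (leq_add ha hb).
Qed.

Lemma hamming_weight_add_delta x (a : 'Z_q) l :
  (wt (x + a *: delta_mx 0 l)%R + (x 0%R l != 0%R) =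
   wt x + ((x 0%R l + a)%R != 0%R))%N.
Proof.
rewrite /wt (bigD1 l) //= [in RHS](bigD1 l) //= !mxE !eqxx mulr1.
rewrite (eq_bigr (fun i => (x 0 i != 0) : nat)).
  by rewrite addnC addnA addnAC.
by move=> i /negbTE il; rewrite !mxE il andbF mulr0 addr0.
Qed.

Lemma hamming_weight_delta (a : 'Z_q) l :
  wt (a *: delta_mx 0 l) = (a != 0).
Proof.
have := hamming_weight_add_delta 0 a l; rewrite !mxE !add0r eqxx addn0.
by move=> ->; rewrite (eqP (_ : wt 0 == 0)%N) ?hamming_weight_eq0.
Qed.

Lemma hamming_weight_eq1P x :
  reflect (exists2 p : 'I_n * 'Z_q, p.2 != 0 & x = p.2 *: delta_mx 0 p.1)
          (wt x == 1)%N.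
Proof.
apply: (iffP idP) => [/eqP x1|[[l a] /= a0 ->]]; last first.
  by rewrite hamming_weight_delta a0.
have [l xl|x0] := pickP (fun l => x 0 l != 0); last first.
  by move: x1; rewrite /wt big1 // => i _; rewrite x0.
exists (l, x 0 l) => //=; apply/eqP; rewrite -subr_eq0 -hamming_weight_eq0.
rewrite -scaleNr; have := hamming_weight_add_delta x (- x 0 l) l.
by rewrite x1 xl subrr eqxx addn0 addn1 => -[->].
Qed.

Lemma cube_adj_sym : symmetric (@cube_adj q n).
Proof. by move=> x y; rewrite !cube_adjE -opprB hamming_weightN. Qed.

Lemma path_hamming_weight x (p : seq (vertex q n)) :
  path (@cube_adj q n) x p -> (wt (last x p - x) <= size p)%N.
Proof.
elim: p x => [|y p IH] x /=; first by rewrite subrr leqn0 hamming_weight_eq0.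
rewrite cube_adjE => /andP[/eqP xy /IH yp].
have -> : last y p - x = (last y p - y) + (y - x) by rewrite addrA subrK.
apply: leq_trans (hamming_weightD _ _) _; rewrite xy; lia.
Qed.

(** Correcting the differing letters one at a time attains the bound of
    [path_hamming_weight]. *)
Lemma exists_geodesic d x y : wt (y - x) = d ->
  exists p : d.-tuple (vertex q n),
    path (@cube_adj q n) x p && (last x p == y).
Proof.
elim: d x => [|d IH] x dE.
  move/eqP: dE; rewrite hamming_weight_eq0 subr_eq0 => /eqP yx.
  by exists [tuple] => /=; rewrite yx.
have [l xl|x0] := pickP (fun l => (y - x) 0 l != 0); last first.
  by move: dE; rewrite /wt big1 // => i _; rewrite x0.
set a := (y - x) 0 l in xl.
have yE : y - (x + a *: delta_mx 0 l) = (y - x) + (- a) *: delta_mx 0 l.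
  by rewrite opprD addrA scaleNr.
have := hamming_weight_add_delta (y - x) (- a) l.
rewrite -yE xl subrr eqxx dE addn0 addn1 => -[/IH[p /andP[xp px]]].
exists [tuple of x + a *: delta_mx 0 l :: p] => /=.
by rewrite xp px cube_adjE [_ - x]addrC addKr hamming_weight_delta xl.
Qed.

Lemma gdist_cube x y : (1 < q)%N ->
  gdist (@cube_adj q n) x y = wt (y - x).
Proof.
move=> q1; set d := wt _.
(* The distances in the cube stay below the cut-off #|T| of [gdist]. *)
rewrite /gdist; set P := fun d => _; set s := iota _ _.
have d_lt : (d < #|{: vertex q n}|)%N.
  rewrite card_mx mul1n card_ord Zp_cast //.
  by apply: leq_ltn_trans (ltn_expl n q1); apply: hamming_weight_le.
have Pd : P d.
  by have [p h] := exists_geodesic (erefl d); apply/existsP; exists p.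
have ds : d \in s by rewrite mem_iota.
have hP : has P s by apply/hasP; exists d.
case: (ltngtP (find P s) d) => // [lt|lt].
  have := nth_find 0%N hP; rewrite nth_iota; last first.
    exact: ltn_trans d_lt.
  case/existsP=> p /andP[/path_hamming_weight xp /eqP px].
  by move: xp; rewrite px size_tuple add0n leqNgt lt.
by have := before_find 0%N lt; rewrite nth_iota // Pd.
Qed.

Lemma sum_cube_adj (V : nmodType) (F : vertex q n -> V) x :
  \sum_(y | cube_adj x y) F y =
  \sum_(l < n) \sum_(a | a != 0) F (x + a *: delta_mx 0 l).
Proof.
rewrite pair_big_dep /=.
pose A := [set p : 'I_n * 'Z_q | p.2 != 0].
pose h (p : 'I_n * 'Z_q) : vertex q n := x + p.2 *: delta_mx 0 p.1.
transitivity (\sum_(y in h @: A) F y).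
  apply: eq_bigl => y; rewrite cube_adjE; apply/hamming_weight_eq1P/imsetP.
    by case=> p p0 yx; exists p; rewrite ?inE // /h -yx addrC subrK.
  by case=> p; rewrite inE => p0 ->; exists p; rewrite // /h addrC addKr.
rewrite big_imset /=; first by apply: eq_bigl => p; rewrite inE.
move=> [l a] [l' a']; rewrite !inE /h /= => a0 _ /addrI/rowP /(_ l).
rewrite !mxE !eqxx mulr1 /=; case: eqP => [->|_]; rewrite ?mulr1 => aE.
  by rewrite aE.
by rewrite aE mulr0 eqxx in a0.
Qed.

(** A position where [u] vanishes is moved into the support by all q - 1
    changes; a position of the support is emptied by one change and kept by
    the q - 2 others. *)
Lemma sum_weight_neighbors (R : pzRingType) (psi : nat -> R) u : (1 < q)%N ->
  \sum_(v | cube_adj u v) psi (wt v) =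
    (q.-1 * (n - wt u))%:R * psi (wt u).+1 +
    (wt u)%:R * (psi (wt u).-1 + q.-2%:R * psi (wt u)).
Proof.
move=> q1; rewrite sum_cube_adj.
have cardZ : #|'Z_q| = q by rewrite card_ord Zp_cast.
have cardZ1 : #|[pred a : 'Z_q | a != 0]| = q.-1.
  by have := cardC1 (0 : 'Z_q); rewrite cardZ.
have nE : (n - wt u = \sum_l (u 0%R l == 0%R))%N.
  rewrite -[n in LHS](card_ord n) -sum1_card.
  rewrite (eq_bigr (fun l => (u 0%R l == 0%R) + (u 0%R l != 0%R))%N);
    last first.
    by move=> l _; case: eqP.
  by rewrite big_split /= addnK.
transitivity (\sum_l ((u 0 l == 0)%:R * (q.-1%:R * psi (wt u).+1) +
   (u 0 l != 0)%:R * (psi (wt u).-1 + q.-2%:R * psi (wt u)))); last first.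
  by rewrite big_split /= -!mulr_suml -!natr_sum -nE natrM mulrA -!natrM mulnC.
apply: eq_bigr => l _; have [ul|ul] /= := eqVneq (u 0 l) 0.
  rewrite mul1r mul0r addr0.
  rewrite (eq_bigr (fun=> psi (wt u).+1)); last first.
    move=> a a0; have := hamming_weight_add_delta u a l.
    by rewrite ul eqxx add0r a0 addn0 addn1 => ->.
  by rewrite sumr_const cardZ1 mulr_natl.
rewrite mul0r mul1r add0r (bigD1 (- u 0 l)) ?oppr_eq0 //=; congr (_ + _).
  have := hamming_weight_add_delta u (- u 0 l) l.
  by rewrite ul subrr eqxx addn0 addn1 => <-.
rewrite (eq_bigr (fun=> psi (wt u))); last first.
  move=> a /andP[_ au]; have := hamming_weight_add_delta u a l.
  by rewrite ul [u 0 l + a]addrC addr_eq0 au !addn1 => -[->].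
rewrite sumr_const mulr_natl; congr (_ *+ _).
rewrite -cardZ1 [in RHS](cardD1 (- u 0 l)) inE oppr_eq0 ul /=.
by apply: eq_card => a; rewrite !inE andbC.
Qed.

End HammingCube.

(** * Block sums *)

Lemma big_mxvec_index (T : Type) (idx : T) (op : Monoid.com_law idx) m n
    (F : 'I_(m * n) -> T) :
  \big[op/idx]_l F l = \big[op/idx]_i \big[op/idx]_j F (mxvec_index i j).
Proof.
rewrite pair_big (reindex _ (curry_mxvec_bij m n)) /=.
by apply: eq_bigr => -[i j].
Qed.

Section BlockSum.
Variables (q m k : nat).
Implicit Types (x y : vertex q (m * k)) (u : vertex q k).

Local Notation wt := (@hamming_weight q _).

Lemma block_sumD x y : block_sum (x + y) = block_sum x + block_sum y.
Proof.
by rewrite /block_sum -big_split; apply: eq_bigr => i _; rewrite !raddfD.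
Qed.

Lemma block_sum_mxvec (A : 'M['Z_q]_(m, k)) :
  block_sum (mxvec A) = \sum_i row i A.
Proof. by rewrite /block_sum mxvecK. Qed.

Lemma block_sum_delta (a : 'Z_q) i j :
  block_sum (a *: delta_mx 0 (mxvec_index i j) : vertex q (m * k)) =
  a *: delta_mx 0 j.
Proof.
rewrite -mxvec_delta -linearZ block_sum_mxvec.
apply/rowP => l; rewrite summxE (bigD1 i) //= big1 ?addr0.
  by rewrite !mxE !eqxx.
by move=> i' /negbTE ii'; rewrite !mxE ii' mulr0.
Qed.

Lemma hamming_weight_mxvec (A : 'M['Z_q]_(m, k)) :
  wt (mxvec A) = (\sum_i wt (row i A))%N.
Proof.
rewrite /hamming_weight big_mxvec_index; apply: eq_bigr => i _.
by apply: eq_bigr => j _; rewrite mxvecE mxE.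
Qed.

(** Applied to [x - y] for a zero [y], this bounds from below the distance from
    [x] to the zero set. *)
Lemma hamming_weight_block_sum x : (wt (block_sum x) <= wt x)%N.
Proof.
rewrite -[x in leqRHS]vec_mxK hamming_weight_mxvec.
exact: hamming_weight_sum.
Qed.

(** The word [u] is written in a single block. *)
Lemma block_sum_lift u : (0 < m)%N ->
  exists2 x : vertex q (m * k), block_sum x = u & wt x = wt u.
Proof.
move=> m0; pose i0 := Ordinal m0.
pose A := \matrix_(i < m) (if i == i0 then u else 0).
have rowA i : row i A = if i == i0 then u else 0 by rewrite rowK.
exists (mxvec A).
  rewrite block_sum_mxvec (bigD1 i0) //= rowA eqxx big1 ?addr0 // => i ne.
  by rewrite rowA (negbTE ne).
rewrite hamming_weight_mxvec (bigD1 i0) //= rowA eqxx big1 ?addn0 // => i ne.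
by apply/eqP; rewrite hamming_weight_eq0 rowA (negbTE ne).
Qed.

Lemma set_dist_block_sum_zeros x : (1 < q)%N -> (0 < m)%N ->
  set_dist (@cube_adj q (m * k)) (block_sum_zeros q m k) x = wt (block_sum x).
Proof.
move=> q1 m0; rewrite /set_dist -minEnat; apply/eqP.
rewrite eqn_leq; apply/andP; split.
  have [y yx wty] := block_sum_lift (block_sum x) m0.
  rewrite -leEnat; apply: (Order.TotalTheory.bigmin_inf (x - y)).
    by rewrite inE -(inj_eq (addIr (block_sum y))) -block_sumD subrK add0r yx.
  by rewrite gdist_cube // subKr leEnat wty.
rewrite -leEnat; apply/Order.TotalTheory.bigmin_geP; split=> [|y].
  rewrite leEnat card_mx mul1n card_ord Zp_cast //.
  apply: leq_trans (hamming_weight_block_sum x) _.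
  apply: leq_trans (hamming_weight_le x) _; exact/ltnW/ltn_expl.
rewrite inE gdist_cube // leEnat => /eqP y0.
rewrite -[x in leqLHS](subrK y) block_sumD y0 addr0.
exact: hamming_weight_block_sum.
Qed.

Lemma covering_radius_block_sum_zeros : (1 < q)%N -> (0 < m)%N ->
  covering_radius (@cube_adj q (m * k)) (block_sum_zeros q m k) = k.
Proof.
move=> q1 m0; apply/eqP; rewrite eqn_leq; apply/andP; split.
  apply/bigmax_leqP => x _; rewrite set_dist_block_sum_zeros //.
  exact: hamming_weight_le.
have [x x1 _] := block_sum_lift (const_mx 1) m0.
apply: leq_trans (leq_bigmax x); rewrite set_dist_block_sum_zeros // x1.
rewrite -[leqLHS](card_ord k) -sum1_card.
by apply: leq_sum => i _; rewrite mxE oner_eq0.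
Qed.

(** Changing one letter of [x] changes the corresponding letter of the block
    sum, and each letter of the block sum is reached from m positions. *)
Lemma sum_cube_adj_block_sum (V : nmodType) (F : vertex q k -> V) x :
  \sum_(y | cube_adj x y) F (block_sum y) =
  (\sum_(v | cube_adj (block_sum x) v) F v) *+ m.
Proof.
rewrite !sum_cube_adj big_mxvec_index -[X in _ *+ X]card_ord -sumr_const.
apply: eq_bigr => i _; apply: eq_bigr => j _; apply: eq_bigr => a _.
by rewrite block_sumD block_sum_delta.
Qed.

End BlockSum.

(** * Krawtchouk polynomials *)

(** This is the coefficient form of a differential equation.  The hypotheses say
    that the generating functions of a and b satisfy [(1 - z) A' = - x A] and
    [(1 + c z) B' = c y B]; hence
    [(1 - z) (1 + c z) (A B)' = (c (1 - z) y - (1 + c z) x) A B]. *)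
Lemma convolution_recurrence (A : comPzRingType) (a b : nat -> A) (x y c : A)
    (conv := fun w => \sum_(j < w.+1) a j * b (w - j)%N) w :
    (forall j, j.+1%:R * a j.+1 = - (x - j%:R) * a j) ->
    (forall i, i.+1%:R * b i.+1 = c * (y - i%:R) * b i) ->
  w.+2%:R * conv w.+2 =
    (c * y - x - (c - 1) * w.+1%:R) * conv w.+1 - c * (x + y - w%:R) * conv w.
Proof.
move=> aS bS.
have splitA v (g : nat -> A) :
    \sum_(j < v.+2) j%:R * (a j * g (v.+1 - j)%N) =
    \sum_(j < v.+1) (j%:R - x) * (a j * g (v - j)%N).
  rewrite big_ord_recl mul0r add0r; apply: eq_bigr => j _ /=.
  by rewrite /bump add1n subSS !mulrA aS opprB.
have splitB v (g : nat -> A) :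
    \sum_(j < v.+2) (v.+1 - j)%N%:R * (g j * b (v.+1 - j)%N) =
    \sum_(j < v.+1) c * (y - (v - j)%N%:R) * (g j * b (v - j)%N).
  rewrite big_ord_recr /= subnn mul0r addr0; apply: eq_bigr => j _ /=.
  by rewrite subSn ?leq_ord // mulrCA bS; ring.
have wE v : v.+1%:R * conv v.+1 =
    \sum_(j < v.+1) (c * (y - (v - j)%N%:R) + (j%:R - x)) * (a j * b (v - j)%N).
  rewrite /conv mulr_sumr.
  rewrite (eq_bigr (fun j : 'I_v.+2 => (v.+1 - j)%N%:R * (a j * b (v.+1 - j)%N)
     + j%:R * (a j * b (v.+1 - j)%N))); last first.
    by move=> j _; rewrite -mulrDl -natrD subnK // leq_ord.
  rewrite big_split /= splitA splitB -big_split /=.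
  by apply: eq_bigr => j _; rewrite -mulrDl.
(* The remainder [c j - (w + 1 - j)] becomes the constant [c (w - x - y)] once
   its two parts are reindexed by [splitA] and [splitB]. *)
rewrite wE (eq_bigr (fun j : 'I_w.+2 =>
   (c * y - x - (c - 1) * w.+1%:R) * (a j * b (w.+1 - j)%N) +
   (c * (j%:R * (a j * b (w.+1 - j)%N)) -
    (w.+1 - j)%N%:R * (a j * b (w.+1 - j)%N)))); last first.
  by move=> j _; rewrite natrB ?leq_ord //; ring.
rewrite big_split /= -mulr_sumr -/(conv _) -addrA; congr (_ + _).
rewrite sumrB -mulr_sumr splitA splitB /conv !mulr_sumr -sumrB.
rewrite -sumrN; apply: eq_bigr => j _; rewrite natrB ?leq_ord //; ring.
Qed.

Section Krawtchouk.
Variable R : realType.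

(** [P_1 i], the eigenvalue of the q-ary n-cube on characters of weight i. *)
Definition cube_eigenvalue n q i : R := (q%:R - 1) * n%:R - q%:R * i%:R.

Lemma cube_eigenvalue_inj n q : (0 < q)%N -> injective (cube_eigenvalue n q).
Proof.
move=> q0; have qn0 : q%:R != 0 :> R by rewrite pnatr_eq0 -lt0n.
move=> i j /addrI/oppr_inj/(mulfI qn0)/eqP.
by rewrite eqr_nat => /eqP.
Qed.

Lemma bin_poly0 : bin_poly R 0 = 1.
Proof. by rewrite /bin_poly big_ord0 invr1 scale1r. Qed.

Lemma bin_polyS j : j.+1%:R * bin_poly R j.+1 = ('X - j%:R) * bin_poly R j.
Proof.
rewrite /bin_poly mulr_natl -scaler_nat scalerA factS natrM invfM mulrA.
rewrite mulfV ?pnatr_eq0 // mul1r -scalerAr big_ord_recr /= polyC_natr.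
by rewrite mulrC.
Qed.

Lemma krawtchouk0 n q : krawtchouk R 0 n q = 1.
Proof.
rewrite /krawtchouk big_ord1 /= expr0 mul1r scale1r bin_poly0 mul1r.
by rewrite comp_polyC.
Qed.

(** Splitting the coefficient between the two factors makes each of them obey a
    first-order recurrence, as [convolution_recurrence] requires. *)
Lemma krawtchouk_conv w n q : krawtchouk R w n q = \sum_(j < w.+1)
  ((-1) ^+ j * bin_poly R j) *
  ((q%:R - 1) ^+ (w - j) * (bin_poly R (w - j) \Po (n%:R%:P - 'X))).
Proof.
apply: eq_bigr => j _.
rewrite -mul_polyC polyCM !polyC_exp polyCN polyCB polyC1 !polyC_natr.
ring.
Qed.

Lemma krawtchouk_recurrence w n q :
  w.+2%:R * krawtchouk R w.+2 n q =
    (krawtchouk R 1 n q - (q%:R - 2) * w.+1%:R) * krawtchouk R w.+1 n q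
    - (q%:R - 1) * (n%:R - w%:R) * krawtchouk R w n q.
Proof.
have := @convolution_recurrence _ (fun j => (-1) ^+ j * bin_poly R j)
  (fun i => (q%:R - 1) ^+ i * (bin_poly R i \Po (n%:R%:P - 'X)))
  'X (n%:R - 'X) (q%:R - 1) w.
rewrite /= -!krawtchouk_conv => ->.
- rewrite krawtchouk1E -mul_polyC !(polyCM, polyCB, polyC1, polyC_natr); ring.
- by move=> j; rewrite mulrCA bin_polyS exprS; ring.
move=> i; rewrite mulrCA.
have := congr1 (fun p => p \Po (n%:R%:P - 'X)) (bin_polyS i).
rewrite !comp_polyM comp_polyB comp_polyX -!polyC_natr !comp_polyC => ->.
by rewrite exprS !polyC_natr; ring.
Qed.

Lemma krawtchouk_Pi0 n q : krawtchouk_Pi R 0 n q = 1.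
Proof. by rewrite /krawtchouk_Pi krawtchouk0 comp_polyC. Qed.

(** Since [P_1] becomes ['X] after the substitution of [P_1^-1], this is the
    same three-term relation as that of the weight levels of the cube. *)
Lemma krawtchouk_Pi_recurrence w n q : (0 < q)%N ->
  w.+2%:R * krawtchouk_Pi R w.+2 n q =
    ('X - (q%:R - 2) * w.+1%:R) * krawtchouk_Pi R w.+1 n q
    - (q%:R - 1) * (n%:R - w%:R) * krawtchouk_Pi R w n q.
Proof.
move=> q0.
have natP k : k%:R \Po krawtchouk1_inv R n q = k%:R :> {poly R}.
  by rewrite -polyC_natr comp_polyC.
have := congr1 (fun p => p \Po krawtchouk1_inv R n q)
  (krawtchouk_recurrence w n q).
rewrite !(comp_polyM, comp_polyB) krawtchouk1K // !natP.
by rewrite -[1 in X in X -> _]polyC1 comp_polyC.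
Qed.

Lemma krawtchouk_Pi1 n q : (0 < q)%N -> krawtchouk_Pi R 1 n q = 'X.
Proof. exact: krawtchouk1K. Qed.

Lemma size_krawtchouk_Pi w n q : (0 < q)%N ->
  size (krawtchouk_Pi R w n q) = w.+1.
Proof.
move=> q0; suff: size (krawtchouk_Pi R w n q) = w.+1 /\
                 size (krawtchouk_Pi R w.+1 n q) = w.+2 by case.
elim: w => [|w [IH0 IH1]].
  by rewrite krawtchouk_Pi0 krawtchouk_Pi1 // size_poly1 size_polyX.
split=> //.
have nz : w.+2%:R != 0 :> R by rewrite pnatr_eq0.
rewrite -(size_scale _ nz) -mul_polyC polyC_natr krawtchouk_Pi_recurrence //.
rewrite -!(polyC_natr, polyC1) -!(polyCB, polyCM).
have P1n0 : krawtchouk_Pi R w.+1 n q != 0 by rewrite -size_poly_gt0 IH1.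
have sX : size (('X - ((q%:R - 2) * w.+1%:R)%:P) * krawtchouk_Pi R w.+1 n q)
    = w.+3.
  by rewrite size_monicM ?monicXsubC // size_XsubC IH1.
rewrite size_polyDl // sX size_polyN mul_polyC.
by apply: leq_ltn_trans (size_scale_leq _ _) _; rewrite IH0.
Qed.

Lemma krawtchouk_coef w i n q : (i <= n)%N ->
  (krawtchouk R w n q).[i%:R] =
  ((1 - 'X) ^+ i * (1 + (q%:R - 1)%:P * 'X) ^+ (n - i))`_w.
Proof.
move=> le_in.
have coef1D (c : R) e j : ((1 + c%:P * 'X) ^+ e)`_j = c ^+ j * 'C(e, j)%:R.
  rewrite exprDn coef_sum.
  under eq_bigr => l _ do
    rewrite expr1n mul1r exprMn -polyC_exp coefMn coefCM coefXn.
  have [lt_ej|le_je] := ltnP e j.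
    rewrite bin_small // mulr0 big1 // => l _; case: eqP => [jE|_].
      by have := ltn_ord l; rewrite -jE; lia.
    by rewrite mulr0 mul0rn.
  have je : (j < e.+1)%N by [].
  rewrite (bigD1 (Ordinal je)) //= big1 ?addr0.
    by rewrite eqxx mulr1 mulr_natr.
  move=> l /eqP ne; case: eqP => [jE|_]; last by rewrite mulr0 mul0rn.
  by case: ne; apply: val_inj.
rewrite coefM /krawtchouk horner_sum; apply: eq_bigr => j _.
have -> : 1 - 'X = 1 + (-1)%:P * 'X :> {poly R}.
  by rewrite polyCN polyC1 mulN1r.
rewrite !coef1D hornerZ hornerM horner_comp hornerD hornerN hornerC hornerX.
rewrite -natrB // !bin_polyE; ring.
Qed.

Lemma size_krawtchouk_generator i n (c : R) : (i <= n)%N ->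
  (size ((1 - 'X) ^+ i * (1 + c%:P * 'X) ^+ (n - i))%R <= n.+1)%N.
Proof.
move=> le_in.
have sz (p : {poly R}) e : (size p <= 2 -> size (p ^+ e)%R <= e.+1)%N.
  move=> p2; apply: leq_trans (size_poly_exp_leq _ _) _; rewrite ltnS.
  by rewrite -[leqRHS]mul1n leq_mul2r; apply/orP; right; case: (size p) p2.
have s1 : (size ((1 - 'X) ^+ i : {poly R}) <= i.+1)%N.
  apply: sz; apply: leq_trans (size_polyD _ _) _.
  by rewrite size_polyN size_poly1 size_polyX.
have s2 : (size ((1 + c%:P * 'X) ^+ (n - i))%R <= (n - i).+1)%N.
  apply: sz; apply: leq_trans (size_polyD _ _) _.
  rewrite size_poly1 mul_polyC geq_max /=.
  by apply: leq_trans (size_scale_leq _ _) _; rewrite size_polyX.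
apply: leq_trans (size_polyMleq _ _) _.
rewrite -[n.+1]/(n.+2.-1) -[in leqRHS](subnKC le_in) -addSn -addnS.
by rewrite -!subn1 leq_sub2r // leq_add.
Qed.

Lemma krawtchouk_generating i n q (z : R) : (i <= n)%N ->
  \sum_(w < n.+1) z ^+ w * (krawtchouk R w n q).[i%:R] =
  (1 - z) ^+ i * (1 + (q%:R - 1) * z) ^+ (n - i).
Proof.
move=> le_in.
have := @horner_coef_wide R n.+1 _ z
  (size_krawtchouk_generator (q%:R - 1) le_in).
rewrite hornerM !horner_exp hornerD hornerN hornerD hornerM !hornerC hornerX.
move=> ->; apply: eq_bigr => w _.
by rewrite krawtchouk_coef // mulrC.
Qed.

Lemma krawtchouk1_inv_eigenvalue i n q : (0 < q)%N ->
  (krawtchouk1_inv R n q).[cube_eigenvalue n q i] = i%:R.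
Proof.
move=> q0; have qn0 : q%:R != 0 :> R by rewrite pnatr_eq0 -lt0n.
rewrite /krawtchouk1_inv hornerZ hornerD hornerN hornerC hornerX.
by rewrite opprB addrC subrK mulKf.
Qed.

(** The values [P_(n+1) i] with [i <= n] are coefficients past the degree of
    the generating polynomial, so the n + 1 eigenvalues of the n-cube are all
    the roots of [Pi_(n+1)]. *)
Lemma krawtchouk_Pi_succ_factor n q : (0 < q)%N ->
  exists2 c : R, c != 0 & krawtchouk_Pi R n.+1 n q =
    c *: \prod_(i < n.+1) ('X - (cube_eigenvalue n q i)%:P).
Proof.
move=> q0.
exists (lead_coef (krawtchouk_Pi R n.+1 n q)).
  by rewrite lead_coef_eq0 -size_poly_gt0 size_krawtchouk_Pi.
rewrite [LHS](@all_roots_prod_XsubC _ _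
  [seq cube_eigenvalue n q i | i : 'I_n.+1]).
- by rewrite big_map big_enum.
- by rewrite size_map size_enum_ord size_krawtchouk_Pi.
- apply/allP => _ /mapP[i _ ->]; apply/eqP.
  rewrite /krawtchouk_Pi horner_comp krawtchouk1_inv_eigenvalue //.
  have in_ : (i <= n)%N by exact: leq_ord.
  rewrite krawtchouk_coef // nth_default //.
  exact: size_krawtchouk_generator.
rewrite uniq_rootsE map_inj_uniq ?enum_uniq // => i j.
by move=> /(cube_eigenvalue_inj q0)/val_inj.
Qed.

End Krawtchouk.

(** * Matrix functions on eigenvectors *)

Section MatrixExponential.
Local Open Scope classical_set_scope.
Variables (R : realType) (n : nat).
Implicit Types (X M : 'M[R]_n.+1) (v : 'rV[R]_n.+1).

Lemma mx_norm_entry X i j : `|X i j| <= `|X|.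
Proof. by rewrite [leRHS]/Num.norm /= mx_normrE (le_bigmax _ _ (i, j)). Qed.

Lemma mx_norm_entries_le X (c : R) : 0 <= c ->
  (forall i j, `|X i j| <= c) -> `|X| <= c.
Proof.
move=> c0 Xc; rewrite [leLHS]/Num.norm /= mx_normrE; apply/bigmax_leP.
by split=> // -[i j] _; apply: Xc.
Qed.

(** The entrywise sup norm is submultiplicative only up to the size of the
    matrices, hence the factor. *)
Lemma expr_mx_entry_le X i j k : `|(X ^+ k) i j| <= (n.+1%:R * `|X|) ^+ k.
Proof.
elim: k i j => [|k IH] i j.
  by rewrite !expr0 mxE; case: (_ == _); rewrite ?normr1 ?normr0.
rewrite exprSr mxE; apply: le_trans (ler_norm_sum _ _ _) _.
rewrite exprSr [n.+1%:R * _]mulrC mulrA -[X in _ * X%:R]card_ord mulr_natr.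
rewrite -sumr_const; apply: ler_sum => l _; rewrite normrM ler_pM //.
  by rewrite mulrC.
exact: mx_norm_entry.
Qed.

Lemma cvg_mx_entries (u : nat -> 'M[R]_n.+1) (l : 'M[R]_n.+1) :
  (forall i j, (fun k => u k i j) @ \oo --> l i j) -> u @ \oo --> l.
Proof.
move=> ul; apply/cvgrPdist_le => /= e e0.
have H i j : \forall k \near \oo, `|l i j - u k i j| <= e.
  by have /cvgrPdist_le := ul i j; apply.
have : \forall k \near \oo, forall ij : 'I_n.+1 * 'I_n.+1,
    `|l ij.1 ij.2 - u k ij.1 ij.2| <= e.
  by apply: filter_forall => -[i j]; apply: H.
apply: filterS => k Hk; apply: mx_norm_entries_le => [|i j]; first exact: ltW.
by rewrite !mxE; apply: (Hk (i, j)).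
Qed.

(** Each entry is dominated by a scalar exponential series; without convergence
    the limit in [mx_exp] would be a junk value. *)
Lemma is_cvg_mx_exp X : cvgn (series (fun k => (k`!%:R)^-1 *: X ^+ k)).
Proof.
set u := fun k => _.
have ent i j : cvgn (series (fun k => u k i j)).
  apply: normed_cvg; apply: (series_le_cvg _ _ _
    (is_cvg_series_exp_coeff (n.+1%:R * `|X|))) => k.
  - exact: normr_ge0.
  - by apply: exp_coeff_ge0; rewrite mulr_ge0.
  rewrite exp_coeffE /u /= mxE normrM ger0_norm ?invr_ge0 //.
  by rewrite ler_wpM2l ?invr_ge0 // expr_mx_entry_le.
apply/cvg_ex; exists (\matrix_(i, j) limn (series (fun k => u k i j))).
apply: cvg_mx_entries => i j; rewrite mxE.
rewrite (_ : (fun k => _) = series (fun k => u k i j)); first exact: ent.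
by apply/funext => k; rewrite /series /= summxE.
Qed.

Lemma row_mul_mx_exp v X (l : R) : v *m X = l *: v ->
  v *m mx_exp X = expR l *: v.
Proof.
move=> vX.
have vXk k : v *m X ^+ k = l ^+ k *: v.
  elim: k => [|k IH]; first by rewrite !expr0 mulmx1 scale1r.
  by rewrite exprS -mulmxE mulmxA vX -scalemxAl IH scalerA exprS.
apply/rowP => j; rewrite !mxE.
pose s := series (fun k => (k`!%:R)^-1 *: X ^+ k).
have s_cvg i : (fun k => s k i j) @ \oo --> mx_exp X i j.
  have s_lim : s @ \oo --> mx_exp X by exact: is_cvg_mx_exp.
  exact: (cvg_comp _ _ s_lim (@coord_continuous _ _ _ i j (mx_exp X))).
have lhs : (fun k => \sum_i v 0 i * s k i j) @ \oo -->
    \sum_i v 0 i * mx_exp X i j.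
  by apply: cvg_big => [|i _]; [exact: add_continuous | exact: cvgMl_tmp].
have rhs : (fun k => series (exp_coeff l) k * v 0 j) @ \oo --> expR l * v 0 j.
  by apply: cvgMr_tmp; exact: is_cvg_series_exp_coeff.
apply: (cvg_unique (@norm_hausdorff _ _) lhs); rewrite (_ : (fun k => _) =
  (fun k => series (exp_coeff l) k * v 0 j)) //.
apply/funext => k.
transitivity ((v *m s k) 0 j); first by rewrite mxE.
rewrite /s /series /= mulmx_sumr summxE mulr_suml.
by apply: eq_bigr => i _; rewrite -scalemxAr vXk !mxE exp_coeffE mulrA.
Qed.

Lemma row_mul_mx_rpow v X (t : R) (e : nat) : 0 < t -> v *m X = e%:R *: v ->
  v *m mx_rpow t X = t ^+ e *: v.
Proof.
move=> t0 vX; rewrite (@row_mul_mx_exp _ _ (e%:R * ln t)).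
  by rewrite expRM_natl lnK.
by rewrite -scalemxAr vX scalerA mulrC.
Qed.

(** At the eigenvalue [l_i] the two exponents of Z are the integers i and
    [k - i]. *)
Lemma row_mul_Zmx v M k q i (z : R) : (0 < q)%N -> (i <= k)%N ->
    0 < 1 - z -> 0 < 1 + (q%:R - 1) * z ->
    v *m M = cube_eigenvalue R k q i *: v ->
  v *m Zmx M k q z = ((1 - z) ^+ i * (1 + (q%:R - 1) * z) ^+ (k - i)) *: v.
Proof.
move=> q0 le_ik z1 z2 vM; have qn0 : q%:R != 0 :> R by rewrite pnatr_eq0 -lt0n.
rewrite /cube_eigenvalue in vM.
rewrite /Zmx mulmxA (@row_mul_mx_rpow v _ _ i) //; last first.
  rewrite -scalemxAr mulmxBr mul_mx_scalar vM -scalerBl scalerA.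
  by congr (_ *: _); field.
rewrite -scalemxAl (@row_mul_mx_rpow v _ _ (k - i)) ?scalerA //.
rewrite -scalemxAr mulmxDr mul_mx_scalar vM -scalerDl scalerA.
by congr (_ *: _); rewrite natrB //; field.
Qed.

Lemma row_mul_horner_mx v M (l : R) (p : {poly R}) : v *m M = l *: v ->
  v *m horner_mx M p = p.[l] *: v.
Proof.
move=> vM; elim/poly_ind: p => [|p c IH].
  by rewrite horner0 rmorph0 mulmx0 scale0r.
rewrite rmorphD rmorphM /= horner_mx_X horner_mx_C !hornerE mulmxDr -mulmxE.
by rewrite mulmxA IH -scalemxAl vM scalerA mul_mx_scalar scalerDl.
Qed.

End MatrixExponential.

(** * Perfect structures *)

Section PerfectStructure.
Variables (R : realType) (nu : nat).

(** The adjacency matrix acts on the weights [phi] instead of on [f]. *)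
Lemma sum_value_mul_perfect (T : finType) (e : rel T) (S : 'M[R]_nu)
    (f : 'M[R]_(#|T|, nu)) (phi : T -> R) :
  symmetric e -> perfect_structure e S f ->
  (\sum_x phi x *: value f x) *m S =
  \sum_x (\sum_(y | e x y) phi y) *: value f x.
Proof.
move=> e_sym hf.
have valS x : value f x *m S = \sum_(y | e x y) value f y.
  rewrite /value -row_mul -hf row_mul mulmx_sum_row.
  rewrite (reindex enum_rank) /=; last exact/onW_bij/enum_rank_bij.
  rewrite [RHS]big_mkcond /=; apply: eq_bigr => y _.
  by rewrite !mxE !enum_rankK; case: (e x y); rewrite ?scale1r ?scale0r.
rewrite mulmx_suml.
under eq_bigr => x _ do rewrite -scalemxAl valS scaler_sumr.
rewrite (exchange_big_dep predT) //=; apply: eq_bigr => y _.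
by rewrite scaler_suml; apply: eq_bigl => x; rewrite e_sym.
Qed.

Section BlockSumStructure.
Variables (q m k : nat).
Hypotheses (q1 : (1 < q)%N) (m0 : (0 < m)%N).
Variables (S : 'M[R]_nu) (f : 'M[R]_(#|{: vertex q (m * k)}|, nu)).
Hypothesis hf : perfect_structure (@cube_adj q (m * k)) S f.

Definition level_sum w : 'rV[R]_nu :=
  \sum_(x | hamming_weight (block_sum x) == w) value f x.

Lemma level_sum_gt w : (k < w)%N -> level_sum w = 0.
Proof.
move=> kw; rewrite /level_sum big_pred0 // => x; apply/eqP => xw.
by have := hamming_weight_le (block_sum x); rewrite xw leqNgt kw.
Qed.

(** Arbitrary weights let a product by S be read as a transformation of psi;
    the level sums are recovered from indicators. *)
Let weighted_sum (psi : nat -> R) : 'rV[R]_nu :=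
  \sum_x psi (hamming_weight (block_sum x)) *: value f x.

Let level_sumE w : level_sum w = weighted_sum (fun v => (v == w)%:R).
Proof.
rewrite /level_sum big_mkcond; apply: eq_bigr => x _.
by case: eqP; rewrite ?scale1r ?scale0r.
Qed.

Let weighted_sum_mul psi : weighted_sum psi *m (m%:R^-1 *: S) =
  weighted_sum (fun v => (q.-1 * (k - v))%:R * psi v.+1 +
                         v%:R * (psi v.-1 + q.-2%:R * psi v)).
Proof.
have mn0 : m%:R != 0 :> R by rewrite pnatr_eq0 -lt0n.
rewrite -scalemxAr (sum_value_mul_perfect _ (@cube_adj_sym _ _) hf).
rewrite scaler_sumr; apply: eq_bigr => x _.
rewrite (sum_cube_adj_block_sum (fun v => psi (hamming_weight v))).
rewrite scalerA; congr (_ *: _).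
by rewrite -[X in _ * X]mulr_natl mulKf // sum_weight_neighbors.
Qed.

Lemma level_sum0_mul :
  level_sum 0 *m (m%:R^-1 *: S) = level_sum 1.
Proof.
rewrite !level_sumE weighted_sum_mul; apply: eq_bigr => x _; congr (_ *: _).
by case: (hamming_weight _) => [|[|v]] /=;
  rewrite !(mulr0, mul0r, addr0, add0r, mulr1).
Qed.

Lemma level_sumS_mul w :
  level_sum w.+1 *m (m%:R^-1 *: S) =
    (q.-1 * (k - w))%:R *: level_sum w + w.+2%:R *: level_sum w.+2
    + (q.-2 * w.+1)%:R *: level_sum w.+1.
Proof.
rewrite !level_sumE weighted_sum_mul /weighted_sum !scaler_sumr -!big_split /=.
apply: eq_bigr => x _; rewrite !scalerA -!scalerDl; congr (_ *: _).
move: (hamming_weight _) => v; rewrite eqSS mulrDr addrA; congr (_ + _ + _).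
- by have [->|] := eqVneq v w; rewrite ?mulr0.
- by case: v => [|v] /=; rewrite ?mul0r ?mulr0 // !eqSS; have [->|] := eqVneq;
    rewrite ?mulr0.
by have [->|] := eqVneq; rewrite ?mulr0 // !mulr1 mulrC natrM.
Qed.

End BlockSumStructure.
End PerfectStructure.

Section Spectral.
Variables (R : realType) (nu q m k : nat).
Hypotheses (q1 : (1 < q)%N) (m0 : (0 < m)%N).
Variables (S : 'M[R]_nu.+1) (f : 'M[R]_(#|{: vertex q (m * k)}|, nu.+1)).
Hypothesis hf : perfect_structure (@cube_adj q (m * k)) S f.

Let S' := m%:R^-1 *: S.
Let h := level_sum f.

(** The range reaches [w = k + 1], where [level_sum_gt] makes the left-hand side
    vanish. *)
Lemma level_sum_krawtchouk w : (w <= k.+1)%N ->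
  h w = h 0 *m horner_mx S' (krawtchouk_Pi R w k q).
Proof.
have q0 : (0 < q)%N by exact: ltnW.
suff H v : (v <= k)%N ->
    h v = h 0 *m horner_mx S' (krawtchouk_Pi R v k q) /\
    h v.+1 = h 0 *m horner_mx S' (krawtchouk_Pi R v.+1 k q).
  case: w => [_|w]; first by case: (H 0%N (leq0n k)).
  by rewrite ltnS => /H[].
elim: v => [_|v IH lt_vk].
  rewrite krawtchouk_Pi0 krawtchouk_Pi1 // rmorph1 mulmx1 horner_mx_X.
  by rewrite /h /S' (level_sum0_mul q1 m0 hf).
have [hv hv1] := IH (ltnW lt_vk); split=> //.
have nz : v.+2%:R != 0 :> R by rewrite pnatr_eq0.
apply: (scalerI nz).
have := level_sumS_mul q1 m0 hf v; rewrite -/S' -/h => rec.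
have qR1 : q.-1%:R = q%:R - 1 :> R by rewrite -subn1 natrB.
have qR2 : q.-2%:R = q%:R - 2 :> R by rewrite -subn2 natrB.
rewrite natrM qR1 natrB ?(ltnW lt_vk) // natrM qR2 in rec.
have -> : v.+2%:R *: h v.+2 = h v.+1 *m S' - ((q%:R - 2) * v.+1%:R) *: h v.+1
    - ((q%:R - 1) * (k%:R - v%:R)) *: h v.
  by rewrite rec addrK addrAC subrr add0r.
have hZ (c : R) p : h 0 *m horner_mx S' (c%:P * p) =
    c *: (h 0 *m horner_mx S' p).
  by rewrite rmorphM /= horner_mx_C -mulmxE mul_scalar_mx scalemxAr.
have hX p : h 0 *m horner_mx S' ('X * p) = h 0 *m horner_mx S' p *m S'.
  by rewrite mulrC rmorphM /= horner_mx_X -mulmxE mulmxA.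
rewrite -hZ polyC_natr krawtchouk_Pi_recurrence //.
rewrite -!(polyC_natr, polyC1) -!(polyCB, polyCM)
  [_ * krawtchouk_Pi R v.+1 k q]mulrBl !rmorphB /= !mulmxBr.
by rewrite !hZ hX -hv -hv1.
Qed.

(** [h_(k+1)] is an empty sum, so the product of the [S' - l_i] over the
    k + 1 distinct eigenvalues [l_i] of the k-cube kills [h_0]; the factors
    being coprime, the kernel of the product is the sum of the eigenspaces. *)
Lemma level_sum0_eigen_decomposition :
  exists2 v : 'I_k.+1 -> 'rV[R]_nu.+1, h 0 = \sum_i v i &
    forall i, v i *m S' = cube_eigenvalue R k q i *: v i.
Proof.
have q0 : (0 < q)%N by exact: ltnW.
have [c c0 PiE] := krawtchouk_Pi_succ_factor R k q0.
have : (h 0 <= kermxpoly S'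
    (\prod_(i < k.+1) ('X - (cube_eigenvalue R k q i)%:P)))%MS.
  apply/sub_kermxP; apply: (scalerI c0).
  rewrite scaler0 scalemxAr -linearZ /= -PiE -level_sum_krawtchouk //.
  exact: level_sum_gt.
rewrite kermxpoly_prod; last first.
  move=> i j _ _ ij; rewrite coprimep_XsubC2 // subr_eq0.
  by rewrite (inj_eq (cube_eigenvalue_inj q0)).
move=> /sub_sumsmxP[u hE].
exists (fun i => u i *m kermxpoly S' ('X - (cube_eigenvalue R k q i)%:P)) => //.
move=> i.
by apply/eigenspaceP; rewrite eigenspace_poly submxMl.
Qed.

End Spectral.

Theorem theorem5 (R : realType) (q m k nu : nat)
    (hq : (1 < q)%N) (hm : (0 < m)%N) (hk : (0 < k)%N)
    (S : 'M[R]_nu.+1) (f : 'M[R]_(#|{: vertex q (m * k)}|, nu.+1))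
    (hf : perfect_structure (@cube_adj q (m * k)) S f) :
  let C := block_sum_zeros q m k in
  let f0 := \sum_(v in C) value f v in
  let S' := m%:R^-1 *: S in
  [/\ f0 = f0 *m horner_mx S' (krawtchouk_Pi R 0 k q),
      weight_distribution (@cube_adj q (m * k)) f C =
        [seq f0 *m horner_mx S' (krawtchouk_Pi R i k q) | i <- iota 0 k.+1]
    & forall z : R, 0 < 1 - z -> 0 < 1 + (q%:R - 1) * z ->
        weight_enumerator (@cube_adj q (m * k)) f C z = f0 *m Zmx S' k q z].
Proof.
move=> C f0 S'.
have q0 : (0 < q)%N by exact: ltnW.
have f0E : f0 = level_sum f 0.
  by apply: eq_bigl => x; rewrite inE hamming_weight_eq0.
have distE : weight_distribution (@cube_adj q (m * k)) f C =
    [seq f0 *m horner_mx S' (krawtchouk_Pi R i k q) | i <- iota 0 k.+1].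
  rewrite /weight_distribution covering_radius_block_sum_zeros //.
  apply/eq_in_map => w; rewrite mem_iota add0n => /andP[_ wk].
  rewrite f0E -(level_sum_krawtchouk hq hm hf) 1?ltnW //.
  by apply: eq_bigl => x; rewrite set_dist_block_sum_zeros.
split=> //; first by rewrite krawtchouk_Pi0 rmorph1 mulmx1.
move=> z z1 z2; rewrite /weight_enumerator distE size_map size_iota.
have [v f0v vS] := level_sum0_eigen_decomposition hq hm hf.
(* Both sides are linear in [f0], so one eigenvector is treated at a time. *)
rewrite f0E f0v mulmx_suml.
under eq_bigr => w _ do
  rewrite (nth_map 0%N) ?size_iota // nth_iota // add0n mulmx_suml scaler_sumr.
rewrite exchange_big /=; apply: eq_bigr => i _.
have le_ik : (i <= k)%N by exact: leq_ord.
rewrite (row_mul_Zmx q0 le_ik z1 z2 (vS i)) -krawtchouk_generating //.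
rewrite scaler_suml; apply: eq_bigr => w _.
rewrite (row_mul_horner_mx _ (vS i)) scalerA /krawtchouk_Pi horner_comp.
by rewrite krawtchouk1_inv_eigenvalue.
Qed.
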